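(* Let $X$ be a real inner product space and suppose that $A$ and $B$ are nonempty subsets of $X$. (i) There is at least one best approximation pair $(a,b)\in A\times B$ relative to $(A,B)$ if and only if $dist(A,B)$ is attained. (ii) If $A$ and $B$ are closed, strictly convex, and $dist(A,B)>0$, then there is at most one best approximation pair $(a,b)\in A\times B$ relative to $(A,B)$. (iii) If $A$ and $B$ are closed, strictly convex, satisfy $dist(A,B)>0$, and the distance between them is attained, then there is exactly one best approximation pair relative to $(A,B)$. In particular, there is exactly one best approximation pair relative to $(A,B)$ whenever $A\subseteq X$ and $B\subseteq X$ are nonempty, strictly convex, compact and $dist(A,B)>0$.
   Context: $dist(A,B):=\inf\{\|u-v\|\mid u\in A,\ v\in B\}$. The distance $dist(A,B)$ is attained if there are $a\in A$ and $b\in B$ such that $\|a-b\|=dist(A,B)$; such a pair $(a,b)$ is called a best approximation pair relative to $(A,B)$. A subset $C$ of $X$ is called strictly convex if for all distinct $x,y\in C$ and all $t\in(0,1)$, the point $tx+(1-t)y$ is in the interior of $C$. *)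

(* Defs.v *)
From mathcomp Require Import all_boot all_order all_algebra sesquilinear.
From mathcomp Require Import boolp classical_sets reals topology normedtype.

Set Implicit Arguments.
Unset Strict Implicit.
Unset Printing Implicit Defensive.

Import Order.TTheory GRing.Theory Num.Theory.
Import numFieldNormedType.Exports.

Local Open Scope classical_set_scope.
Local Open Scope ring_scope.

(* The pair (X, form) is a real inner product space: [form] is a symmetric,
   positive definite bilinear form, and the norm of X (hence its topology) is
   the one induced by [form]. *)
Definition inner_product_norm (R : realType) (X : normedModType R)
    (form : {dot X for idfun}) : Prop :=
  forall x : X, `|x| = Num.sqrt (form x x).

Section BestApproximation.
Context {R : realType} {X : normedModType R}.
Implicit Types A B C : set X.

(* [inf] is real valued, so [dist] is meaningful only for nonempty A and B. *)
Definition dist A B : R := inf [set `|u - v| | u in A & v in B].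

Definition dist_attained A B : Prop :=
  exists a b : X, [/\ A a, B b & `|a - b| = dist A B].

Definition best_approximation_pair A B (p : X * X) : Prop :=
  [/\ A p.1, B p.2 & `|p.1 - p.2| = dist A B].

Definition strictly_convex_set C : Prop :=
  forall x y : X, C x -> C y -> x <> y ->
  forall t : R, 0 < t -> t < 1 -> interior C (t *: x + (1 - t) *: y).

End BestApproximation.

(* Main.v *)
(** If two best approximation pairs (a, b), (c, d) had a <> c, then the midpoint
    m of a and c would be interior to A, and the midpoint n of b and d would
    belong to B, with |m - n| <= dist A B by the triangle inequality.  As
    m <> n, moving m slightly towards n keeps it inside A while strictly
    decreasing its distance to n: a contradiction.  The case b <> d follows by
    exchanging A and B. *)
Require Import Defs.
From mathcomp Require Import all_boot all_order all_algebra sesquilinear.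
From mathcomp Require Import boolp classical_sets reals topology normedtype.
From mathcomp Require Import derive.

Set Implicit Arguments.
Unset Strict Implicit.
Unset Printing Implicit Defensive.

Import Order.TTheory GRing.Theory Num.Theory.
Import numFieldNormedType.Exports.

Local Open Scope classical_set_scope.
Local Open Scope ring_scope.

Section BestApproximation.
Context {R : realType} {X : normedModType R}.
Implicit Types (A B C : set X) (p q : X * X).

Lemma dist_le A B u v : A u -> B v -> dist A B <= `|u - v|.
Proof.
move=> Au Bv; apply: ge_inf; last by exists u => //; exists v.
(* [inf] is known to lie below each member only for a set bounded below; 0 bounds all norms. *)
by exists 0 => _ [x _ [y _ <-]]; exact: normr_ge0.
Qed.

Lemma distC A B : dist A B = dist B A.
Proof.
congr inf; apply/seteqP; split=> _ [u Cu [v Dv <-]];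
  by exists v => //; exists u => //; rewrite distrC.
Qed.

Lemma dist_lt_interior A B u v :
  0 < dist A B -> interior A u -> B v -> dist A B < `|u - v|.
Proof.
move=> dist_gt0 Au Bv.
(* Separation of [u] and [v] leaves room for a strict decrease of the distance. *)
have uv_gt0 : 0 < `|u - v|.
  by apply: lt_le_trans dist_gt0 _; apply: dist_le => //; exact: interior_subset.
(* As [A] is a neighbourhood of [u], this limit keeps the displaced point in [A] for all small
   [t > 0]. *)
have cvg_u : u + t *: (v - u) @[t --> (0 : R)^'+] --> u.
  rewrite -[X in _ --> X]addr0 -(scale0r (v - u)).
  apply: cvgD; first exact: cvg_cst.
  by apply: cvgZr_tmp; exact: cvg_at_right_filter.
have [t [Aut t01]] :
    exists t, A (u + t *: (v - u)) /\ 0 < t < 1.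
  have : \forall t \near (0 : R)^'+, A (u + t *: (v - u)) /\ 0 < t < 1.
    near=> t; split; first by near: t; exact: cvg_u.
    by apply/andP; split; near: t; [exact: nbhs_right_gt | exact: nbhs_right_lt].
  exact: filter_ex.
case/andP: t01 => t_gt0 t_lt1; apply: le_lt_trans (dist_le Aut Bv) _.
(* The displacement shrinks the distance to [v] by the factor [1 - t < 1]. *)
have -> : u + t *: (v - u) - v = (1 - t) *: (u - v).
  by rewrite scalerBl scale1r addrAC -[v - u]opprB scalerN.
rewrite normrZ gtr0_norm ?subr_gt0// gtr_pMl//.
by rewrite ltrBlDr ltrDl.
Unshelve. all: by end_near. Qed.

(** Strict convexity speaks of distinct points only; for equal points the combination collapses to
    the point itself. This serves the side on which two pairs may share a component. *)
Lemma strictly_convex_set_convex C x y (t : R) :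
  strictly_convex_set C -> C x -> C y -> 0 < t -> t < 1 ->
  C (t *: x + (1 - t) *: y).
Proof.
move=> convC Cx Cy t_gt0 t_lt1; have [<-|xy] := pselect (x = y).
  by rewrite -scalerDl addrC subrK scale1r.
by apply: interior_subset; exact: convC.
Qed.

Lemma best_approximation_pair_swap A B p :
  best_approximation_pair A B p -> best_approximation_pair B A (p.2, p.1).
Proof. by case=> Ap Bp dist_p; split=> //=; rewrite distrC dist_p distC. Qed.

Lemma best_approximation_pair_fst A B p q :
  strictly_convex_set A -> strictly_convex_set B -> 0 < dist A B ->
  best_approximation_pair A B p -> best_approximation_pair A B q ->
  p.1 = q.1.
Proof.
move=> convA convB dist_gt0 [Ap Bp dist_p] [Aq Bq dist_q].
apply: contrapT => pq.
(* The weight 1/2 is a mere choice: any weight strictly between 0 and 1 yields the same bound. *)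
have h_gt0 : 0 < 2^-1 :> R by rewrite invr_gt0.
have h_lt1 : 2^-1 < 1 :> R by rewrite invf_lt1 ?ltr1n.
have := dist_lt_interior dist_gt0 (convA _ _ Ap Aq pq _ h_gt0 h_lt1)
  (strictly_convex_set_convex convB Bp Bq h_gt0 h_lt1).
(* The difference of the midpoints is regrouped as the midpoint of [p.1 - p.2] and [q.1 - q.2], both
   of norm [dist A B]. *)
apply/negP; rewrite -leNgt opprD addrACA -!scalerBr.
apply: le_trans (ler_normD _ _) _.
rewrite !normrZ dist_p dist_q -mulrDl !gtr0_norm ?subr_gt0//.
by rewrite addrC subrK mul1r.
Qed.

Lemma best_approximation_pair_unique A B p q :
  strictly_convex_set A -> strictly_convex_set B -> 0 < dist A B ->
  best_approximation_pair A B p -> best_approximation_pair A B q -> p = q.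
Proof.
move=> convA convB dist_gt0 bp bq.
have eq1 := best_approximation_pair_fst convA convB dist_gt0 bp bq.
rewrite distC in dist_gt0.
have /= eq2 := best_approximation_pair_fst convB convA dist_gt0
  (best_approximation_pair_swap bp) (best_approximation_pair_swap bq).
by rewrite [p]surjective_pairing [q]surjective_pairing eq1 eq2.
Qed.

Lemma best_approximation_pair_exists A B :
  (exists p, best_approximation_pair A B p) <-> dist_attained A B.
Proof. by split=> [[[a b] ab]|[a [b ab]]]; [exists a, b | exists (a, b)]. Qed.

(** The continuous function [|p.1 - p.2|] has a minimum on the compact product of [A] and [B], and
    this minimum is the infimum. *)
Lemma compact_dist_attained A B :
  A !=set0 -> B !=set0 -> compact A -> compact B -> dist_attained A B.
Proof.
move=> [a Aa] [b Bb] cptA cptB.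
have [||[u v] /set_mem[/= Au Bv] uv_min] := compact_EVT_min
    (f := fun p : X * X => `|p.1 - p.2|) _ (compact_setX cptA cptB).
- by exists (a, b).
- apply: continuous_subspaceT => p; apply: cvg_norm.
  by apply: cvgB; [exact: cvg_fst | exact: cvg_snd].
exists u, v; split=> //; apply/le_anti; rewrite dist_le// andbT.
(* The minimal value is a lower bound of the distances, hence at most their [inf], as there is at
   least one distance. *)
apply: lb_le_inf; first by exists `|a - b|; exists a => //; exists b.
by move=> _ [x Ax [y By <-]]; apply: (uv_min (x, y)); apply/mem_set.
Qed.

Lemma best_approximation_pair_exists_unique A B :
  strictly_convex_set A -> strictly_convex_set B -> 0 < dist A B ->
  dist_attained A B -> exists! p, best_approximation_pair A B p.
Proof.
move=> convA convB dist_gt0 /best_approximation_pair_exists[p bp].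
by exists p; split=> // q bq; exact: (best_approximation_pair_unique convA convB).
Qed.

End BestApproximation.

Theorem proposition16 (R : realType) (X : normedModType R)
    (form : {dot X for idfun}) (X_inner : inner_product_norm form)
    (A B : set X) (A_nonempty : A !=set0) (B_nonempty : B !=set0) :
  [/\ (exists p : X * X, best_approximation_pair A B p) <-> dist_attained A B,
      closed A -> closed B ->
      strictly_convex_set A -> strictly_convex_set B ->
      0 < dist A B ->
      forall p q : X * X,
        best_approximation_pair A B p -> best_approximation_pair A B q -> p = q,
      closed A -> closed B ->
      strictly_convex_set A -> strictly_convex_set B ->
      0 < dist A B -> dist_attained A B ->
      exists! p : X * X, best_approximation_pair A B p &
      strictly_convex_set A -> strictly_convex_set B ->
      compact A -> compact B ->
      0 < dist A B ->
      exists! p : X * X, best_approximation_pair A B p].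
Proof.
split.
- exact: best_approximation_pair_exists.
- by move=> _ _ convA convB dist_gt0 p q; exact: best_approximation_pair_unique.
- by move=> _ _; exact: best_approximation_pair_exists_unique.
- move=> convA convB cptA cptB dist_gt0.
  apply: best_approximation_pair_exists_unique => //.
  exact: compact_dist_attained.
Qed.
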